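(* Let $\Gamma=(X,R)$ be a bipartite distance-regular graph with diameter $D\ge4$ and valency $k\ge3$, fix $x\in X$, let $W$ be a thin irreducible $T(x)$-module with endpoint $2$ and local eigenvalue $\eta$ with $\tilde\theta_1<\eta<\tilde\theta_d$, and let $v$ be a nonzero vector in $E^*_2W$. (i) If $\eta\ne-1$, then with $\psi=b_2\bigl(1-\frac{b_3}{1+\eta}\bigr)$, $$E^*_{i+2}A_iv=\sum_{\substack{h=0\\ i-h\ \text{even}}}^{i}\frac{P_h(\psi)}{P_i(\psi)}\,\frac{k_ib_ib_{i+1}}{k_hb_hb_{h+1}}\,p_h(A)v\qquad(0\le i\le D-2).$$ (ii) If $\eta=-1$, then $E^*_{i+2}A_iv=p_i(A)v$ for $0\le i\le D-2$.
   Context: $\Gamma$ is a finite connected bipartite distance-regular graph with distance $\partial$, intersection numbers $c_i,b_i$ ($c_0=0,b_D=0$), $k_i=b_0\cdots b_{i-1}/(c_1\cdots c_i)$. $A_i$ distance matrices, $A=A_1$, eigenvalues $\theta_0>\dots>\theta_D$; $d=\lfloor D/2\rfloor$. $E^*_i$ diagonal with $(y,y)$-entry $1$ if $\partial(x,y)=i$, else $0$; $T(x)$ generated by $A,E^*_0,\dots,E^*_D$; thin: $\dim E^*_iW\le1$ for all $i$; endpoint $\min\{i:E^*_iW\ne0\}$; local eigenvalue of a thin irreducible $W$ with endpoint 2: eigenvalue of $E^*_2A_2E^*_2$ on $E^*_2W$. $\tilde\theta_1=-1-b_2b_3(\theta_1^2-b_2)^{-1}$, $\tilde\theta_d=-1-b_2b_3(\theta_d^2-b_2)^{-1}$.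 Polynomials: $f_0=1,f_{-1}=0$, $\lambda f_i=b_{i-1}f_{i-1}+c_{i+1}f_{i+1}$ $(0\le i\le D-1)$; $p_i=f_i+f_{i-2}+\cdots$ (ending in $f_0$ if $i$ even, $f_1$ if $i$ odd); $P_i\in\mathbb{R}[\lambda]$ with $p_i(\lambda)=P_i(\lambda^2)$ for $i$ even and $p_i(\lambda)=\lambda P_i(\lambda^2)$ for $i$ odd. (For such $\eta\ne-1$, $P_i(\psi)\ne0$ for $0\le i\le D$.) *)

(* Defs.v *)
From HB Require Import structures.
From mathcomp Require Import all_boot all_order all_algebra.

Set Implicit Arguments.
Unset Strict Implicit.
Unset Printing Implicit Defensive.

Import Order.TTheory GRing.Theory Num.Theory.
Local Open Scope ring_scope.

Section Graph.

Variables (X : finType) (e : rel X).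

Definition walk (n : nat) (x y : X) : bool :=
  [exists s : n.-tuple X, path e x s && (last x s == y)].

(* The least length of a walk from x to y; it is #|X| when there is none, and
   always < #|X| in a connected graph. *)
Definition dist (x y : X) : nat := find (fun n => walk n x y) (iota 0 #|X|).

Definition diameter : nat := (\max_(u : X * X) dist u.1 u.2)%N.

Definition simple_graph : Prop := symmetric e /\ irreflexive e.

Definition connected_graph : Prop := forall x y, connect e x y.

Definition bipartite : Prop :=
  exists Y : {set X}, forall x y, e x y -> (x \in Y) != (y \in Y).

Definition regular (k : nat) : Prop := forall x, #|[set z | e x z]| = k.

(* For y at distance i from x, y has c i neighbours at distance i - 1 from x
   and b i neighbours at distance i + 1. In particular c 0 = 0 and b D = 0;
   the values of b and c beyond the diameter D are unconstrained. *)
Definition distance_regular (b c : nat -> nat) : Prop :=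
  [/\ simple_graph, connected_graph &
      forall x y,
        #|[set z | e y z & (dist x z).+1 == dist x y]| = c (dist x y) /\
        #|[set z | e y z & dist x z == (dist x y).+1]| = b (dist x y)].

End Graph.

Section Terwilliger.

Variables (C : numClosedFieldType) (X : finType) (e : rel X).

(* Matrices with rows and columns indexed by X, via the enumeration of X. *)
Definition distmx (i : nat) : 'M[C]_#|X| :=
  \matrix_(r, s) (dist e (enum_val r) (enum_val s) == i)%:R.

Definition adjmx : 'M[C]_#|X| := distmx 1.

Variable x : X.

Definition dual_idem (i : nat) : 'M[C]_#|X| :=
  diag_mx (\row_r (dist e x (enum_val r) == i)%:R).

Inductive terwilliger : 'M[C]_#|X| -> Prop :=
| terwilliger_A : terwilliger adjmx
| terwilliger_E i : (i <= diameter e)%N -> terwilliger (dual_idem i)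
| terwilliger_1 : terwilliger 1%:M
| terwilliger_Z a M : terwilliger M -> terwilliger (a *: M)
| terwilliger_D M N : terwilliger M -> terwilliger N -> terwilliger (M + N)
| terwilliger_M M N : terwilliger M -> terwilliger N -> terwilliger (M *m N).

Definition Tmodule (W : {vspace 'cV[C]_#|X|}) : Prop :=
  forall M, terwilliger M -> forall w, w \in W -> M *m w \in W.

Definition irreducible_Tmodule (W : {vspace 'cV[C]_#|X|}) : Prop :=
  [/\ Tmodule W, W != 0%VS &
      forall U : {vspace 'cV[C]_#|X|},
        Tmodule U -> (U <= W)%VS -> U = 0%VS \/ U = W].

Definition subconst (i : nat) (W : {vspace 'cV[C]_#|X|}) :
    {vspace 'cV[C]_#|X|} :=
  (linfun (mulmx (dual_idem i) : 'cV[C]_#|X| -> 'cV[C]_#|X|) @: W)%VS.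

Definition thin (W : {vspace 'cV[C]_#|X|}) : Prop :=
  forall i, (i <= diameter e)%N -> (\dim (subconst i W) <= 1)%N.

Definition has_endpoint (W : {vspace 'cV[C]_#|X|}) (r : nat) : Prop :=
  subconst r W != 0%VS /\ forall i, (i < r)%N -> subconst i W = 0%VS.

Definition local_eigenvalue (W : {vspace 'cV[C]_#|X|}) (eta : C) : Prop :=
  exists u, [/\ u \in subconst 2 W, u != 0 &
    (dual_idem 2 *m distmx 2 *m dual_idem 2) *m u = eta *: u].

End Terwilliger.

(* theta 0 > theta 1 > ... > theta D are exactly the eigenvalues of M. In C,
   t < s means that s - t is a positive real. *)
Definition eigenvalue_enum (C : numClosedFieldType) (n : nat) (M : 'M[C]_n)
    (D : nat) (theta : nat -> C) : Prop :=
  (forall i, (i < D)%N -> theta i.+1 < theta i) /\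
  (forall a, eigenvalue M a <-> exists2 i, (i <= D)%N & a = theta i).

(* horner_mx is only available for sizes of the form n.+1. *)
Definition polymx (F : comNzRingType) (n : nat) (p : {poly F}) (M : 'M[F]_n) :
    'M[F]_n :=
  \sum_(i < size p) p`_i *: M ^+ i.

Section Polynomials.

Variables (F : fieldType) (b c : nat -> nat).

Definition kparam (i : nat) : F :=
  (\prod_(j < i) (b j)%:R) / (\prod_(j < i) (c j.+1)%:R).

Definition theta_tilde (t : F) : F :=
  - 1 - (b 2%N)%:R * (b 3%N)%:R * (t ^+ 2 - (b 2%N)%:R)^-1.

(* The recurrence fpolyE below, solved for the term of highest index. *)
Fixpoint fpoly (i : nat) : {poly F} :=
  match i with
  | 0 => 1
  | j.+1 =>
    match j with
    | 0 => ((c 1%N)%:R)^-1 *: 'X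
    | h.+1 => ((c j.+1)%:R)^-1 *: ('X * fpoly j - (b h)%:R *: fpoly h)
    end
  end.

Definition ppoly (i : nat) : {poly F} :=
  \sum_(j < i.+1 | ~~ odd (i - j)) fpoly j.

(* The polynomial P_i such that p_i(t) = P_i(t^2) or t P_i(t^2), according to
   the parity of i (ppolyE below). *)
Definition Ppoly (i : nat) : {poly F} :=
  if odd i then odd_poly (ppoly i) else even_poly (ppoly i).

Lemma fpolyE (i : nat) : (c i.+1)%:R != 0 :> F ->
  'X * fpoly i =
  (if i is j.+1 then (b j)%:R *: fpoly j else 0) + (c i.+1)%:R *: fpoly i.+1.
Proof.
case: i => [|i] ci0 /=; first by rewrite scalerA divff // scale1r mulr1 add0r.
by rewrite [X in _ = _ + X]scalerA divff // scale1r addrC subrK.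
Qed.

Lemma fpoly_parity (i : nat) :
  if odd i then even_poly (fpoly i) = 0 else odd_poly (fpoly i) = 0.
Proof.
suff [] : (if odd i then even_poly (fpoly i) = 0 else odd_poly (fpoly i) = 0)
  /\ (if odd i.+1 then even_poly (fpoly i.+1) = 0
      else odd_poly (fpoly i.+1) = 0) by [].
elim: i => [|i [IH1 IH2]].
  split=> /=; first by rewrite -polyC1 odd_polyC.
  rewrite even_polyZ -['X]mul1r even_polyMX -polyC1 odd_polyC.
  by rewrite mul0r scaler0.
split=> //; move: IH1 IH2.
rewrite -[odd i.+2]/(~~ ~~ odd i) negbK -[odd i.+1]/(~~ odd i).
rewrite -[fpoly i.+2]/(((c i.+2)%:R)^-1 *:
  ('X * fpoly i.+1 - (b i)%:R *: fpoly i)).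
rewrite [_ * fpoly i.+1]mulrC -scaleNr.
case: (odd i) => /= IH1 IH2.
  rewrite even_polyZ even_polyD even_polyZ even_polyMX IH1 IH2.
  by rewrite mul0r scaler0 addr0 scaler0.
rewrite odd_polyZ odd_polyD odd_polyZ odd_polyMX IH1 IH2.
by rewrite scaler0 addr0 scaler0.
Qed.

Lemma ppolyE (i : nat) :
  ppoly i = (if odd i then 'X else 1) * (Ppoly i \Po 'X^2).
Proof.
have H : if odd i then even_poly (ppoly i) = 0 else odd_poly (ppoly i) = 0.
  rewrite /ppoly; case: ifP => oi.
    apply: (big_ind (fun p => even_poly p = 0)).
    - by rewrite -polyC0 even_polyC.
    - by move=> p q Hp Hq; rewrite even_polyD Hp Hq addr0.
    move=> j; have ji : (j <= i)%N by rewrite -ltnS.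
    by rewrite oddB // oi; have := fpoly_parity j; case: (odd j).
  apply: (big_ind (fun p => odd_poly p = 0)).
  - by rewrite -polyC0 odd_polyC.
  - by move=> p q Hp Hq; rewrite odd_polyD Hp Hq addr0.
  move=> j; have ji : (j <= i)%N by rewrite -ltnS.
  by rewrite oddB // oi; have := fpoly_parity j; case: (odd j).
rewrite -[LHS]poly_even_odd /Ppoly; move: H; case: (odd i) => ->.
  by rewrite comp_poly0 add0r mulrC.
by rewrite comp_poly0 mul0r addr0 mul1r.
Qed.

End Polynomials.

(* Main.v *)
(* By bipartiteness A_i v lives on the levels i - 2, i, i + 2 of x. Write u_j,
   m_j, d_j for the components on level j + 2 of A_j v, A_(j+2) v, A_(j+4) v.
   As v is orthogonal to the all-ones vector, u_j + m_j + d_j = 0, and the sums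
   defining p_i(A) v telescope to p_(i+2)(A) v = u_(i+2) - d_i.  The recurrence
   for A A_i, read level by level, gives
     R u_j = c_(j+1) u_(j+1),  L d_(j+1) = b_(j+4) d_j,
     L u_(j+1) + R m_(j-1) = b_j u_j + c_(j+2) m_j,
   where L and R are the lowering and raising parts of A.  By irreducibility and
   thinness L is injective on every level of W above the second.
   Since d_0 = -(1 + eta) v, if eta = -1 then all d_j vanish, which is (ii).
   Otherwise d_j and u_j are nonzero for j <= D - 4, and by thinness
   d_j = B_j u_j; the relations above determine B_j recursively, and comparison
   with the recurrence 'X p_i = c_(i+1) p_(i+1) + b_(i+1) p_(i-1)
   at psi yields B_j = b_(j+2) b_(j+3) P_j(psi) / (c_(j+1) c_(j+2) P_(j+2)(psi)) with
   a nonzero denominator, whence (i) by telescoping. *)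

Require Import Defs.
From HB Require Import structures.
From mathcomp Require Import all_boot all_order all_algebra.
From mathcomp Require Import zify ring.

Set Implicit Arguments.
Unset Strict Implicit.
Unset Printing Implicit Defensive.

Import Order.TTheory GRing.Theory Num.Theory.
Local Open Scope ring_scope.

(** * Graph distance, geodesics and the diameter *)

Section Distance.

Variables (X : finType) (e : rel X).
Hypotheses (sym_e : symmetric e) (conn_e : connected_graph e).

Lemma walkP (n : nat) (y z : X) :
  reflect (exists s : seq X, [/\ size s = n, path e y s & last y s = z])
          (walk e n y z).
Proof.
apply: (iffP existsP) => [[s /andP[ps /eqP ls]]|[s [<- ps ls]]].
  by exists s; rewrite size_tuple.
by exists (in_tuple s); rewrite /= ps ls eqxx.
Qed.

Lemma walk_sym (n : nat) (y z : X) : walk e n y z -> walk e n z y.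
Proof.
move=> /walkP[s [<- ps ls]]; apply/walkP; exists (rev (belast y s)).
rewrite size_rev size_belast -ls; split=> //.
  by rewrite rev_path; under eq_path => ? ? do rewrite sym_e.
by case: s ps ls => // a s _ _; rewrite /= rev_cons last_rcons.
Qed.

Lemma walk_cat (m n : nat) (y z w : X) :
  walk e m y z -> walk e n z w -> walk e (m + n) y w.
Proof.
move=> /walkP[s [<- ps ls]] /walkP[t [<- pt lt]]; apply/walkP; exists (s ++ t).
by rewrite size_cat cat_path last_cat ls ps pt.
Qed.

Lemma dist_le_walk (n : nat) (y z : X) : walk e n y z -> (dist e y z <= n)%N.
Proof.
move=> wn; rewrite leqNgt; apply/negP => lt_n.
have := before_find 0%N lt_n; rewrite nth_iota ?add0n ?wn //.
by rewrite (leq_trans lt_n) // -[leqRHS](size_iota 0) find_size.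
Qed.

(** A connecting path can be shortened to one without repeated vertices, so its length is below
    [#|X|] and the search defining [dist] succeeds. *)
Lemma walk_dist (y z : X) : walk e (dist e y z) y z.
Proof.
have: has (fun n => walk e n y z) (iota 0 #|X|).
  have /connectP[p pp lp] := conn_e y z.
  case/shortenP: pp lp => q pq uq _ lq.
  apply/hasP; exists (size q); last by apply/walkP; exists q.
  by rewrite mem_iota leq0n add0n; have := max_card (mem (y :: q));
     rewrite (card_uniqP uq).
move=> hw; have := nth_find 0%N hw.
by rewrite -[find _ _]/(dist e y z) nth_iota ?add0n // -[ltnRHS](size_iota 0)
  -has_find.
Qed.

Lemma dist_sym (y z : X) : dist e y z = dist e z y.
Proof.
apply/eqP; rewrite eqn_leq.
by rewrite !dist_le_walk //; apply: walk_sym; apply: walk_dist.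
Qed.

Lemma dist_triangle (y z w : X) : (dist e y w <= dist e y z + dist e z w)%N.
Proof. by apply/dist_le_walk/walk_cat; apply: walk_dist. Qed.

Lemma dist_eq0 (y z : X) : (dist e y z == 0%N) = (y == z).
Proof.
apply/eqP/eqP => [d0|->].
  by have := walk_dist y z; rewrite d0 => /walkP[s [/size0nil -> _ <-]].
by apply/eqP; rewrite -leqn0; apply/dist_le_walk/walkP; exists [::].
Qed.

Lemma dist_eq1 (y z : X) : irreflexive e -> (dist e y z == 1%N) = e y z.
Proof.
move=> irr_e; apply/eqP/idP => [d1|eyz].
  have := walk_dist y z; rewrite d1 => /walkP[[|a [|? ?]] [//= _]].
  by rewrite andbT => ? <-.
apply/eqP; rewrite eqn_leq lt0n dist_eq0 dist_le_walk.
  by apply: contraTneq eyz => ->; rewrite irr_e.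
by apply/walkP; exists [:: z]; rewrite /= eyz.
Qed.

(** Cut a shortest walk after [n] steps; by the triangle inequality neither piece can be
    shortened. *)
Lemma geodesic (n m : nat) (y z : X) : dist e y z = (n + m)%N ->
  exists2 w, dist e y w = n & dist e w z = m.
Proof.
move=> dyz; have := walk_dist y z; rewrite dyz => /walkP[s [ss ps ls]].
have ws : walk e n y (last y (take n s)).
  apply/walkP; exists (take n s); split=> //.
    by rewrite size_takel // ss leq_addr.
  by move: ps; rewrite -{1}(cat_take_drop n s) cat_path => /andP[].
have wt : walk e m (last y (take n s)) z.
  apply/walkP; exists (drop n s); split=> //.
  - by rewrite size_drop ss addKn.
  - by move: ps; rewrite -{1}(cat_take_drop n s) cat_path => /andP[].
  by rewrite -last_cat cat_take_drop.
exists (last y (take n s)); move: (dist_le_walk ws) (dist_le_walk wt);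
  have := dist_triangle y (last y (take n s)) z; lia.
Qed.

Lemma dist_le_diameter (y z : X) : (dist e y z <= diameter e)%N.
Proof. exact: (leq_bigmax (y, z)). Qed.

(** Positivity excludes an empty vertex set, where the maximum is an unattained 0. *)
Lemma diameter_attained :
  (0 < diameter e)%N -> exists y z, dist e y z = diameter e.
Proof.
move=> D0; have [XX0|XX_gt0] := posnP #|{: X * X}|.
  by move: D0; rewrite /diameter big_pred0 // => i; have := card0_eq XX0 i.
have [[y z]] := @bigop.eq_bigmax (X * X)%type (fun u => dist e u.1 u.2) XX_gt0.
by rewrite /diameter => ->; exists y, z.
Qed.

Lemma dist_parity (Y : {set X}) (y z : X) :
  (forall y z, e y z -> (y \in Y) != (z \in Y)) ->
  odd (dist e y z) = (y \in Y) (+) (z \in Y).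
Proof.
move=> hY; have /walkP[s [<- ps <-]] := walk_dist y z.
elim: s y ps => [|a s IH] y /=; first by rewrite addbb.
case/andP=> /hY hya /IH ->; move: hya.
by case: (y \in Y); case: (a \in Y); case: (last a s \in Y).
Qed.

End Distance.

(** * Intersection numbers of a bipartite distance-regular graph *)

Section DistanceRegular.

Variables (X : finType) (e : rel X) (b c : nat -> nat).
Hypotheses (hdr : distance_regular e b c) (hbip : bipartite e).

Let sym_e : symmetric e. Proof. by case: hdr => [[]]. Qed.
Let irr_e : irreflexive e. Proof. by case: hdr => [[]]. Qed.
Let conn_e : connected_graph e. Proof. by case: hdr. Qed.

Lemma odd_dist (x y z : X) :
  odd (dist e x z) = odd (dist e x y) (+) odd (dist e y z).
Proof.
case: hbip => Y hY; rewrite !(dist_parity conn_e _ _ hY).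
by case: (x \in Y); case: (y \in Y); case: (z \in Y).
Qed.

Lemma dist_neighbor (x y z : X) : e y z ->
  (dist e x z).+1 = dist e x y \/ dist e x z = (dist e x y).+1.
Proof.
rewrite -(dist_eq1 conn_e) // => /eqP d1; have := odd_dist x y z.
move: (dist_triangle conn_e x y z) (dist_triangle conn_e x z y).
rewrite (dist_sym sym_e conn_e z y) d1 => *; lia.
Qed.

Lemma drg_c1 : (0 < diameter e)%N -> c 1 = 1%N.
Proof.
move=> D0; have [x0 [y0 d0]] := diameter_attained D0.
have [|x d1 _] := @geodesic _ e conn_e 1 (diameter e).-1 x0 y0.
  by rewrite d0 add1n prednK.
have [_ _ /(_ x0 x) [+ _]] := hdr; rewrite d1 => <-.
apply: (etrans _ (cards1 x0)); apply: eq_card => z; rewrite !inE eqSS dist_eq0 // eq_sym.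
apply: andb_idl => /eqP ->; rewrite -(dist_eq1 conn_e) // dist_sym //.
by rewrite d1.
Qed.

Lemma drg_c0 : (0 < diameter e)%N -> c 0 = 0%N.
Proof.
move=> D0; have [x0 _] := diameter_attained D0.
have [_ _ /(_ x0 x0) [+ _]] := hdr.
have /eqP -> : dist e x0 x0 == 0%N by rewrite dist_eq0.
by move=> <-; apply/eqP; rewrite cards_eq0 -subset0; apply/subsetP => z;
  rewrite !inE andbF.
Qed.

(** A geodesic between two vertices at distance D has consecutive vertices at distances [i] and
    [i.+1] from its origin. *)
Lemma drg_b_gt0 (i : nat) : (i < diameter e)%N -> (0 < b i)%N.
Proof.
move=> iD; have [x0 [y0 d0]] := diameter_attained (leq_ltn_trans (leq0n _) iD).
have [|w dw _] := @geodesic _ e conn_e i.+1 (diameter e - i.+1) x0 y0.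
  by rewrite d0 subnKC.
have [|z dz zw] := @geodesic _ e conn_e i 1 x0 w; first by rewrite addn1.
have [_ _ /(_ x0 z) [_ +]] := hdr; rewrite dz => <-.
rewrite card_gt0; apply/set0Pn; exists w.
by rewrite inE dw eqxx -(dist_eq1 conn_e) // zw.
Qed.

Lemma drg_c_gt0 (i : nat) : (i < diameter e)%N -> (0 < c i.+1)%N.
Proof.
move=> iD; have [x0 [y0 d0]] := diameter_attained (leq_ltn_trans (leq0n _) iD).
have [|w dw _] := @geodesic _ e conn_e i.+1 (diameter e - i.+1) x0 y0.
  by rewrite d0 subnKC.
have [|z dz zw] := @geodesic _ e conn_e i 1 x0 w; first by rewrite addn1.
have [_ _ /(_ x0 w) [+ _]] := hdr; rewrite dw => <-.
rewrite card_gt0; apply/set0Pn; exists z.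
by rewrite inE dz eqxx sym_e -(dist_eq1 conn_e) // zw.
Qed.

(** Bipartiteness leaves no neighbour at equal distance, so the neighbours split into the two
    counted sets. *)
Lemma drg_bDc (i : nat) (k : nat) :
  (0 < diameter e)%N -> regular e k -> (i <= diameter e)%N -> (b i + c i = k)%N.
Proof.
move=> D0 regk iD; have [x0 [y0 d0]] := diameter_attained D0.
have [|w dw _] := @geodesic _ e conn_e i (diameter e - i) x0 y0.
  by rewrite d0 subnKC.
have [_ _ /(_ x0 w) [+ +]] := hdr; rewrite dw => <- <-.
rewrite -(regk w) -cardsUI -[RHS]addn0; congr (_ + _)%N; last first.
  by apply/eqP; rewrite cards_eq0 -subset0; apply/subsetP => z; rewrite !inE;
    lia.
apply: eq_card => z; rewrite !inE -andb_orr andb_idr // => /(dist_neighbor x0).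
by rewrite dw; case=> ->; rewrite eqxx ?orbT.
Qed.

End DistanceRegular.

(** * Vectors and distance matrices seen level by level from x *)

Section Levels.

Variables (C : numClosedFieldType) (X : finType) (e : rel X) (b c : nat -> nat).
Hypotheses (hdr : distance_regular e b c) (hbip : bipartite e).
Variable x : X.

Let sym_e : symmetric e. Proof. by case: hdr => [[]]. Qed.
Let irr_e : irreflexive e. Proof. by case: hdr => [[]]. Qed.
Let conn_e : connected_graph e. Proof. by case: hdr. Qed.

Local Notation E := (dual_idem C e x).
Local Notation A := (distmx C e).
Implicit Types w : 'cV[C]_#|X|.

(** The sum of the dual idempotents over the levels in [S], used to cut a module along a set of
    levels. *)
Definition level_proj (S : pred nat) : 'M[C]_#|X| :=
  diag_mx (\row_r (S (dist e x (enum_val r)))%:R).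

Lemma level_projE (S : pred nat) w r :
  (level_proj S *m w) r 0 = (S (dist e x (enum_val r)))%:R * w r 0.
Proof. by rewrite mul_diag_mx !mxE. Qed.

Lemma dual_idemE (i : nat) w r :
  (E i *m w) r 0 = (dist e x (enum_val r) == i)%:R * w r 0.
Proof. exact: (level_projE (fun l => l == i)). Qed.

Lemma distmxE (i : nat) w r :
  (A i *m w) r 0 = \sum_s (dist e (enum_val r) (enum_val s) == i)%:R * w s 0.
Proof. by rewrite mxE; apply: eq_bigr => s _; rewrite mxE. Qed.

Lemma dual_idemM (i j : nat) w :
  E i *m (E j *m w) = if i == j then E i *m w else 0.
Proof.
apply/matrixP => r s; rewrite ord1 dual_idemE dual_idemE.
case: (i =P j) => [<-|/eqP neq]; rewrite ?dual_idemE ?mxE.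
  by case: eqP; rewrite ?mul0r ?mul1r.
by case: eqP => [->|]; rewrite ?mul0r // (negPf neq) !(mul0r, mulr0).
Qed.

Lemma dual_idem_big (i : nat) w : (diameter e < i)%N -> E i *m w = 0.
Proof.
move=> iD; apply/matrixP => r s; rewrite ord1 dual_idemE mxE.
case: eqP => [di|]; last by rewrite mul0r.
by move: iD; rewrite -di ltnNge dist_le_diameter.
Qed.

Lemma distmx_big (i : nat) : (diameter e < i)%N -> A i = 0.
Proof.
move=> iD; apply/matrixP => r s; rewrite !mxE.
case: eqP => // di; by move: iD; rewrite -di ltnNge dist_le_diameter.
Qed.

Lemma distmx0 : A 0 = 1%:M.
Proof.
by apply/matrixP => r s; rewrite !mxE dist_eq0 // (inj_eq enum_val_inj).
Qed.

Lemma eq_levels w w' : (forall l, E l *m w = E l *m w') -> w = w'.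
Proof.
move=> eqE; apply/matrixP => r s; rewrite ord1.
have /matrixP/(_ r 0) := eqE (dist e x (enum_val r)).
by rewrite !dual_idemE eqxx !mul1r.
Qed.

(** The entry at (y, z) counts the neighbours of y at distance [i.+1] from z; by bipartiteness z is
    then at distance [i] or [i.+2] from y. *)
Lemma adjmx_distmx (i : nat) :
  A 1 *m A i.+1 = (b i)%:R *: A i + (c i.+2)%:R *: A i.+2.
Proof.
apply/matrixP => r s; rewrite !mxE.
set y := enum_val r; set z := enum_val s.
transitivity (#|[set t | e y t & dist e z t == i.+1]|%:R : C).
  rewrite -sum1dep_card natr_sum [RHS]big_mkcond /=.
  rewrite [RHS](reindex _ (onW_bij _ (@enum_val_bij X))) /=.
  apply: eq_bigr => t _; rewrite !mxE dist_eq1 // (dist_sym sym_e conn_e z).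
  by rewrite -natrM mulnb; case: (_ && _).
have [_ _ /(_ z y) [Nc Nb]] := hdr; rewrite (dist_sym sym_e conn_e y z).
have [di|ni] := eqVneq (dist e z y) i.
  move: Nb; rewrite di => ->.
  by rewrite (_ : (i == i.+2) = false) ?mulr1 ?mulr0 ?addr0 //; lia.
have [di|ni2] := eqVneq (dist e z y) i.+2.
  by move: Nc; rewrite di => <-; rewrite mulr0 mulr1 add0r.
rewrite !mulr0 addr0; apply/eqP; rewrite pnatr_eq0 cards_eq0 -subset0.
apply/subsetP => t; rewrite !inE => /andP[/(dist_neighbor hdr hbip z)].
by move=> + /eqP dt; move: ni ni2; rewrite dt; lia.
Qed.

Lemma raise_lower (j : nat) w :
  E j.+1 *m (A 1 *m w) =
  E j.+1 *m (A 1 *m (E j *m w)) + E j.+1 *m (A 1 *m (E j.+2 *m w)).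
Proof.
apply/matrixP => r s; rewrite ord1 [RHS]mxE !dual_idemE !distmxE -mulrDr.
case: eqP => [dr|]; last by rewrite !mul0r.
congr (_ * _); rewrite -big_split /=; apply: eq_bigr => t _.
rewrite dist_eq1 //; have [ert|] := boolP (e _ _); last by rewrite !mul0r addr0.
rewrite !mul1r !dual_idemE -mulrDl -natrD.
have := dist_neighbor hdr hbip x ert; rewrite dr => dt.
by case: dt => [[->]|->]; rewrite !eqxx ?[_ == _.+2]ltn_eqF ?gtn_eqF ?mul1r.
Qed.

Variable v : 'cV[C]_#|X|.
Hypothesis Ev : E 2 *m v = v.

Lemma supp_level2 r : v r 0 = 0 \/ dist e x (enum_val r) = 2%N.
Proof.
rewrite -Ev dual_idemE; case: eqP => [|_]; first by right.
by left; rewrite mul0r.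
Qed.

(** A vertex of level l and one of level 2 are at distance between |l - 2| and l + 2, of the parity
    of l. *)
Lemma level_dist0 (l i : nat) :
  i != l -> i != l.+2 -> l != i.+2 -> E l *m (A i *m v) = 0.
Proof.
move=> il il2 li2; apply/matrixP => r s; rewrite ord1 dual_idemE distmxE mxE.
case: eqP => [dr|]; rewrite ?mul0r // mul1r big1 // => t _.
case: eqP => [dt|]; rewrite ?mul0r // mul1r.
have [//|d2] := supp_level2 t; exfalso.
have := dist_triangle conn_e x (enum_val r) (enum_val t).
have := dist_triangle conn_e x (enum_val t) (enum_val r).
have := dist_triangle conn_e (enum_val t) x (enum_val r).
have := odd_dist hdr hbip x (enum_val r) (enum_val t).
rewrite (dist_sym sym_e conn_e (enum_val t) (enum_val r)).
rewrite (dist_sym sym_e conn_e (enum_val t) x) dr dt d2.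
by move: il il2 li2; lia.
Qed.

(** The distance from level j + 2 to a vertex of level 2 is j, j + 2 or j + 4, so every entry of the
    sum on that level is the total of the entries of v. *)
Lemma sum_level (j : nat) : E 0 *m (A 2 *m v) = 0 ->
  E j.+2 *m (A j *m v) + E j.+2 *m (A j.+2 *m v) + E j.+2 *m (A j.+4 *m v) = 0.
Proof.
(* The entry of [E 0 *m (A 2 *m v)] at x is the total of the entries of v. *)
move=> /matrixP/(_ (enum_rank x) 0); rewrite dual_idemE distmxE mxE enum_rankK.
have /eqP -> : dist e x x == 0%N by rewrite dist_eq0.
rewrite eqxx mul1r => sum0; apply/matrixP => r s; rewrite ord1 [LHS]mxE.
rewrite [X in X + _]mxE !dual_idemE -!mulrDr !distmxE -!big_split /= [RHS]mxE.
case: eqP => [dr|]; rewrite ?mul0r // mul1r -[RHS]sum0.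
apply: eq_bigr => t _; rewrite -!mulrDl -!natrD.
have [->|d2] := supp_level2 t; first by rewrite !mulr0.
congr (_%:R * _).
have := dist_triangle conn_e (enum_val r) x (enum_val t).
have := dist_triangle conn_e x (enum_val t) (enum_val r).
have := odd_dist hdr hbip x (enum_val r) (enum_val t).
rewrite (dist_sym sym_e conn_e (enum_val t) (enum_val r)).
rewrite (dist_sym sym_e conn_e (enum_val r) x) dr d2.
rewrite eqxx; set d := dist _ _ _ => par le1 le2.
case: (d =P j) => ?; case: (d =P j.+2) => ?; case: (d =P j.+4) => ?.
all: by [] || (exfalso; lia).
Qed.

End Levels.

Lemma sum_same_parity (V : nmodType) (i : nat) (F : nat -> V) :
  \sum_(h < i.+3 | ~~ odd (i.+2 - h)) F h =
  \sum_(h < i.+1 | ~~ odd (i - h)) F h + F i.+2.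
Proof.
rewrite big_mkcond 2!big_ord_recr /= subnn /= subSnn addr0; congr (_ + _).
rewrite [RHS]big_mkcond; apply: eq_bigr => j _ /=.
have ji : (j <= i)%N by rewrite -ltnS.
by rewrite !subSn ?leqW //= negbK.
Qed.

(** * Evaluation of polynomials at a matrix *)

Section PolyMatrix.

Variables (F : comNzRingType) (n : nat) (M : 'M[F]_n).
Implicit Types p q : {poly F}.

Lemma polymx_wide (m : nat) p : (size p <= m)%N ->
  polymx p M = \sum_(i < m) p`_i *: M ^+ i.
Proof.
move=> pm; rewrite /polymx (big_ord_widen _ (fun i => p`_i *: M ^+ i) pm).
rewrite big_mkcond; apply: eq_bigr => i _.
by case: ltnP => // ?; rewrite nth_default ?scale0r.
Qed.

Lemma polymxD p q : polymx (p + q) M = polymx p M + polymx q M.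
Proof.
rewrite !(@polymx_wide (maxn (size p) (size q))) ?leq_maxl ?leq_maxr ?size_polyD //.
by rewrite -big_split; apply: eq_bigr => i _; rewrite coefD scalerDl.
Qed.

Lemma polymxZ a p : polymx (a *: p) M = a *: polymx p M.
Proof.
rewrite !(@polymx_wide (size p)) ?size_scale_leq // scaler_sumr.
by apply: eq_bigr => i _; rewrite coefZ scalerA.
Qed.

Lemma polymxXM p : polymx ('X * p) M = M *m polymx p M.
Proof.
rewrite (@polymx_wide (size p).+1); last first.
  by rewrite (leq_trans (size_polyMleq _ _)) // size_polyX.
rewrite big_ord_recl coefXM scale0r add0r /polymx mulmx_sumr.
apply: eq_bigr => i _.
by rewrite coefXM /= -scalemxAr exprS.
Qed.

Lemma polymx1 : polymx 1 M = 1%:M.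
Proof. by rewrite /polymx size_poly1 big_ord1 coef1 scale1r. Qed.

End PolyMatrix.

(** * Three-term recurrences for p_i and P_i *)

Section PolynomialRecurrences.

Variables (F : numFieldType) (b c : nat -> nat) (D k : nat).
Hypotheses (c0 : c 0%N = 0%N) (c_gt0 : forall i, (i < D)%N -> (0 < c i.+1)%N).
Hypothesis bDc : forall i, (i <= D)%N -> (b i + c i = k)%N.

Local Notation f := (fpoly F b c).
Local Notation p := (ppoly F b c).
Local Notation P := (Ppoly F b c).

Lemma ppoly0 : p 0 = 1.
Proof. by rewrite /ppoly big_mkcond big_ord1. Qed.

Lemma ppoly1 : p 1 = f 1.
Proof. by rewrite /ppoly big_mkcond 2!big_ord_recr big_ord0 /= !add0r. Qed.

Lemma ppolyS2 (i : nat) : p i.+2 = p i + f i.+2.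
Proof. exact: sum_same_parity. Qed.

Let cF (i : nat) : (i < D)%N -> (c i.+1)%:R != 0 :> F.
Proof. by move/c_gt0; rewrite pnatr_eq0 lt0n. Qed.

(** Summing the recurrences of the f_j, each f_m with m = i, i - 2, ... gets the coefficient b_m +
    c_m = k, and f_(i+2) gets c_(i+2). Both sides are thus c_(i+2) f_(i+2) + k p_i; at m = 0 this
    uses c_0 = 0. *)
Lemma ppoly_rec (i : nat) : (i.+2 <= D)%N ->
  'X * p i.+1 = (c i.+2)%:R *: p i.+2 + (b i.+2)%:R *: p i.
Proof.
have bc (j : nat) : (j <= D)%N ->
    (b j)%:R%:P = k%:R%:P - (c j)%:R%:P :> {poly F}.
  by move=> jD; rewrite -(bDc jD) natrD polyCD addrK.
have fE (j : nat) : (j.+1 < D)%N ->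
    'X * f j.+1 = (b j)%:R%:P * f j + (c j.+2)%:R%:P * f j.+2.
  by move=> jD; rewrite (fpolyE _ (cF jD)) !mul_polyC.
rewrite -!mul_polyC; elim/ltn_ind: i => -[_ D2|[_ D3|i IH iD]].
- rewrite ppoly1 ppolyS2 ppoly0 fE // !bc // c0 /= polyC0; ring.
- have fE0 : 'X = (c 1%N)%:R%:P * f 1.
    have := fpolyE b (cF (ltn_trans (ltn0Sn 1) D3)).
    by rewrite mulr1 add0r mul_polyC.
  rewrite !ppolyS2 ppoly1 ppoly0 mulrDr mulr1 (fE 1%N) // [in LHS]fE0.
  by rewrite !bc ?(leq_trans _ D3) //; ring.
rewrite [p i.+3]ppolyS2 mulrDr IH; [|by lia..].
rewrite fE // [p i.+4]ppolyS2 [p i.+2]ppolyS2.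
rewrite !bc; [|by lia..].
ring.
Qed.

Lemma Ppoly0E (t : F) : (P 0).[t] = 1.
Proof.
by rewrite /Ppoly ppoly0 /= -polyC1 even_polyC hornerC.
Qed.

Lemma Ppoly1E (t : F) : (0 < D)%N -> (c 1)%:R * (P 1).[t] = 1.
Proof.
move=> D0; rewrite /Ppoly ppoly1 /= odd_polyZ -['X]mul1r odd_polyMX.
by rewrite -polyC1 even_polyC hornerZ hornerC mulr1 divff // cF.
Qed.

(** Take odd or even parts in [ppoly_rec], with [t] standing for the square of the variable: a
    factor [t] appears when p_(i+1) is odd and is multiplied by one more 'X. *)
Lemma Ppoly_rec (t : F) (i : nat) : (i.+2 <= D)%N ->
  (if odd i.+1 then t else 1) * (P i.+1).[t] =
  (c i.+2)%:R * (P i.+2).[t] + (b i.+2)%:R * (P i).[t].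
Proof.
move=> /ppoly_rec; rewrite mulrC /Ppoly /= negbK; case: (odd i) => /= E.
  have := congr1 (fun q => (odd_poly q).[t]) E.
  by rewrite odd_polyMX odd_polyD !odd_polyZ hornerD !hornerZ mul1r.
have := congr1 (fun q => (even_poly q).[t]) E.
rewrite even_polyMX even_polyD !even_polyZ hornerD !hornerZ hornerMX => <-.
by rewrite mulrC.
Qed.

End PolynomialRecurrences.

(** * Distance matrices as polynomials in A *)

Section DistancePolynomials.

Variables (C : numClosedFieldType) (X : finType) (e : rel X) (b c : nat -> nat).
Hypotheses (hdr : distance_regular e b c) (hbip : bipartite e).

Let c_neq0 (i : nat) : (i < diameter e)%N -> (c i.+1)%:R != 0 :> C.
Proof. by move/(drg_c_gt0 hdr); rewrite pnatr_eq0 lt0n. Qed.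

Lemma fpoly_distmx (i : nat) : (i <= diameter e)%N ->
  polymx (fpoly C b c i) (adjmx C e) = distmx C e i.
Proof.
elim/ltn_ind: i => -[_ _|[_ D1|i IH iD]].
- by rewrite /= polymx1 (distmx0 _ hdr).
- rewrite /= (drg_c1 hdr D1) invr1 scale1r -['X]mulr1 polymxXM polymx1.
  by rewrite mulmx1.
rewrite -[fpoly _ _ _ i.+2]/(((c i.+2)%:R)^-1 *:
  ('X * fpoly C b c i.+1 - (b i)%:R *: fpoly C b c i)).
rewrite polymxZ -scaleNr polymxD polymxXM polymxZ !IH; [|by lia..].
rewrite (adjmx_distmx _ hdr hbip) scaleNr addrAC subrr add0r scalerA mulVf.
  by rewrite scale1r.
exact: c_neq0.
Qed.

End DistancePolynomials.

(** * Thin irreducible modules and their submodules cut out by levels *)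

Section ThinModule.

Variables (C : numClosedFieldType) (X : finType) (e : rel X) (b c : nat -> nat).
Hypotheses (hdr : distance_regular e b c) (hbip : bipartite e).
Variables (x : X) (W : {vspace 'cV[C]_#|X|}).
Hypotheses (hirr : irreducible_Tmodule e x W) (hthin : thin e x W).

Local Notation E := (dual_idem C e x).
Local Notation A := (distmx C e).
Local Notation D := (diameter e).
Local Notation proj := (level_proj C e x).
Implicit Types u w : 'cV[C]_#|X|.

Lemma module_dual_idem (i : nat) w : w \in W -> E i *m w \in W.
Proof.
move=> Ww; have [iD|iD] := leqP i D; last by rewrite dual_idem_big ?mem0v.
by have [TW _ _] := hirr; apply: TW => //; apply: terwilliger_E.
Qed.

Lemma module_distmx (i : nat) w : w \in W -> A i *m w \in W.
Proof.
move=> Ww; have [TW _ _] := hirr.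
elim/ltn_ind: i => -[_|[_|i IH]]; first by rewrite (distmx0 _ hdr) mul1mx.
  by apply: TW => //; apply: terwilliger_A.
have [iD|iD] := ltnP i.+1 D; last by rewrite distmx_big // mul0mx mem0v.
have c_neq0 : (c i.+2)%:R != 0 :> C.
  by rewrite pnatr_eq0 -lt0n (drg_c_gt0 hdr).
(* Solve the three-term relation for A_(i+2), so that closure under A suffices. *)
rewrite -[A i.+2 *m w]scale1r -(mulVf c_neq0) -scalerA memvZ // scalemxAl.
rewrite -[_ *: A i.+2](addKr ((b i)%:R *: A i)) -(adjmx_distmx _ hdr hbip).
rewrite mulmxDl mulNmx addrC memvB //; last by rewrite -scalemxAl memvZ ?IH.
by rewrite -mulmxA; apply: TW; [apply: terwilliger_A | apply: IH].
Qed.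

Lemma module_level_proj (S : pred nat) w : w \in W -> proj S *m w \in W.
Proof.
move=> Ww; suff -> : proj S *m w = \sum_(i < D.+1 | S i) E i *m w.
  by apply: memv_suml => i _; apply: module_dual_idem.
apply/matrixP => r s; rewrite ord1 level_projE summxE.
under eq_bigr => i _ do rewrite dual_idemE.
rewrite -mulr_suml; congr (_ * _).
have dD : (dist e x (enum_val r) < D.+1)%N by rewrite ltnS dist_le_diameter.
rewrite big_mkcond (bigD1 (Ordinal dD)) //= eqxx big1 ?addr0; first by case: ifP.
move=> i; rewrite -val_eqE /= eq_sym => /negPf ->.
by rewrite if_same.
Qed.

Lemma subconstP (i : nat) w :
  reflect (w \in W /\ E i *m w = w) (w \in subconst e x i W).
Proof.
apply: (iffP memv_imgP) => [[u Wu ->]|[Ww Ew]].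
  by rewrite lfunE /= dual_idemM eqxx module_dual_idem.
by exists w; rewrite // lfunE /= Ew.
Qed.

Lemma thin_scalar (i : nat) u w : u != 0 -> u \in W -> w \in W ->
  E i *m u = u -> E i *m w = w -> exists a, w = a *: u.
Proof.
move=> u0 Wu Ww Eu Ew; have [iD|iD] := leqP i D; last first.
  by move: u0; rewrite -Eu dual_idem_big // eqxx.
apply/vlineP; suff /eqP -> : (<[u]> == subconst e x i W)%VS.
  exact/subconstP.
rewrite eqEdim -memvE dim_vline u0 hthin // andbT.
exact/subconstP.
Qed.

(* The image of W under a projection onto a set of levels that A does not
   leave is a submodule. *)
Lemma irr_cut (S : pred nat) :
  (forall w, w \in W -> proj S *m (A 1 *m (proj S *m w)) = A 1 *m (proj S *m w))
  -> (forall w, w \in W -> proj S *m w = 0) \/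
     (forall w, w \in W -> proj S *m w = w).
Proof.
move=> stabS; have [TW _ minW] := hirr.
have projK w : proj S *m (proj S *m w) = proj S *m w.
  apply/matrixP => r s; rewrite ord1 !level_projE mulrA -natrM mulnb.
  by rewrite andbb.
pose U := (linfun (mulmx (proj S) : 'cV[C]_#|X| -> 'cV[C]_#|X|) @: W)%VS.
have UP w : w \in U <-> w \in W /\ proj S *m w = w.
  split=> [/memv_imgP[u Wu ->]|[Ww Fw]].
    by rewrite lfunE /= projK module_level_proj.
  by apply/memv_imgP; exists w; rewrite // lfunE /= Fw.
have [||U0|UW] := minW U.
(* Stability of [U] is checked on generators: [stabS] handles A, and the dual idempotents commute
   with the projection, both being diagonal. *)
- move=> M; elim=> {M} [|i iD||a M _ IH|M N _ IHM _ IHN|M N _ IHM _ IHN] w Uw.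
  + have /UP[Ww Fw] := Uw; apply/UP; split; first exact: module_distmx.
    by rewrite -[w]Fw; apply: stabS.
  + have /UP[Ww Fw] := Uw; apply/UP; split; first exact: module_dual_idem.
    rewrite -{2}Fw; apply/matrixP => r s.
    by rewrite ord1 !(dual_idemE, level_projE) mulrCA.
  + by rewrite mul1mx.
  + by rewrite -scalemxAl memvZ ?IH.
  + by rewrite mulmxDl memvD ?IHM ?IHN.
  + by rewrite -mulmxA; apply/IHM/IHN.
- by apply/subvP => w /UP[].
- left=> w Ww; apply/eqP; rewrite -memv0 -U0; apply/UP.
  by rewrite projK module_level_proj.
by right=> w; rewrite -{1}UW => /UP[].
Qed.

End ThinModule.

(* The induction step from (B_(j-1), B_j) to B_(j+1), with c_j B_(j-1) hidden in
   Y = b_(j+2) + c_j B_(j-1) so that the case j = 0 is covered. *)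
Lemma ratio_step (F : fieldType) (B B' l Y t P0 P1 P2 P3 c1 c2 c3 b2 b3 b4 : F) :
  l = Y - c2 * B -> Y * (c1 * P1) = b2 * (t * P0) ->
  B * (c1 * c2 * P2) = b2 * b3 * P0 -> t * P2 = c3 * P3 + b3 * P1 ->
  B' * l = b4 * B -> l != 0 -> c1 != 0 -> b2 != 0 ->
  P0 != 0 -> P1 != 0 -> P2 != 0 ->
  P3 != 0 /\ B' * (c2 * c3 * P3) = b3 * b4 * P1.
Proof.
move=> lE YE BE tE B'E l0 c10 b20 P00 P10 P20.
(* The left side is nonzero, which forces [P3] to be nonzero. *)
have lP : l * (c1 * P1 * P2) = b2 * P0 * (c3 * P3).
  have -> : c3 * P3 = t * P2 - b3 * P1 by rewrite tE addrK.
  transitivity (Y * (c1 * P1) * P2 - B * (c1 * c2 * P2) * P1).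
    by rewrite lE; ring.
  by rewrite YE BE; ring.
have P3_neq0 : P3 != 0.
  have : l * (c1 * P1 * P2) != 0 by rewrite !mulf_neq0.
  by apply: contraNneq => P30; rewrite lP P30 !mulr0.
split=> //; have bP : b2 * P0 != 0 by rewrite mulf_neq0.
apply: (mulfI bP).
transitivity (B' * (b2 * P0 * (c3 * P3)) * c2); first by ring.
rewrite -lP; transitivity (B' * l * (c1 * P1 * P2) * c2); first by ring.
rewrite B'E; transitivity (b4 * P1 * (B * (c1 * c2 * P2))); first by ring.
by rewrite BE; ring.
Qed.

Lemma kparamS (F : fieldType) (b c : nat -> nat) (i : nat) :
  kparam F b c i.+1 = kparam F b c i * ((b i)%:R / (c i.+1)%:R).
Proof. by rewrite /kparam !big_ord_recr /= invfM; ring. Qed.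

(** The field identity behind [scaleP_down]: k (b0 / c1) (b1 / c2) is k_(j+2) when k is k_j. *)
Lemma scale_step (F : fieldType) (B p p2 k b0 b1 b2 b3 c1 c2 : F) :
  B * (c1 * c2 * p2) = b2 * b3 * p -> k != 0 -> b0 != 0 -> b1 != 0 ->
  b2 != 0 -> b3 != 0 -> c1 != 0 -> c2 != 0 ->
  p2 / (k * (b0 / c1) * (b1 / c2) * b2 * b3) * B = p / (k * b0 * b1).
Proof.
move=> BE k0 b00 b10 b20 b30 c10 c20.
have -> : p = B * (c1 * c2 * p2) / (b2 * b3).
  by rewrite BE; field; rewrite b20 b30.
by field; rewrite k0 b00 b10 b20 b30 c10 c20.
Qed.

(** * The components of A_i v when W has endpoint 2 *)

Section EndpointTwo.

Variables (C : numClosedFieldType) (X : finType) (e : rel X) (b c : nat -> nat).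
Hypotheses (hdr : distance_regular e b c) (hbip : bipartite e).
Variables (x : X) (W : {vspace 'cV[C]_#|X|}) (v : 'cV[C]_#|X|).
Hypotheses (hirr : irreducible_Tmodule e x W) (hthin : thin e x W).

Local Notation E := (dual_idem C e x).
Local Notation A := (distmx C e).
Local Notation D := (diameter e).
Local Notation proj := (level_proj C e x).
Implicit Types u w : 'cV[C]_#|X|.

Hypotheses (Wv : v \in W) (Ev : E 2 *m v = v) (v_neq0 : v != 0).
Hypothesis Wlow : forall i w, (i < 2)%N -> w \in W -> E i *m w = 0.
Hypothesis D4 : (4 <= D)%N.

Let D_gt0 : (0 < D)%N. Proof. exact: leq_trans D4. Qed.

(* The components on level j + 2 of A_j v, A_(j+2) v and A_(j+4) v: the shift
   avoids negative indices. *)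
Definition up j := E j.+2 *m (A j *m v).
Definition mid j := E j.+2 *m (A j.+2 *m v).
Definition down j := E j.+2 *m (A j.+4 *m v).

Let W_E i w : w \in W -> E i *m w \in W.
Proof. exact: module_dual_idem. Qed.
Let W_A i w : w \in W -> A i *m w \in W.
Proof. exact: (module_distmx hdr hbip hirr). Qed.

Let up_mem j : up j \in W. Proof. by rewrite W_E ?W_A. Qed.
Let down_mem j : down j \in W. Proof. by rewrite W_E ?W_A. Qed.

Let E_up j : E j.+2 *m up j = up j. Proof. by rewrite dual_idemM eqxx. Qed.
Let E_down j : E j.+2 *m down j = down j. Proof. by rewrite dual_idemM eqxx. Qed.

Let level0 l i : i != l -> i != l.+2 -> l != i.+2 -> E l *m (A i *m v) = 0.
Proof. exact: (level_dist0 hdr hbip Ev). Qed.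

Let up0 : up 0 = v.
Proof. by rewrite /up (distmx0 _ hdr) mul1mx. Qed.

Let mulAA i : A 1 *m (A i.+1 *m v) =
  (b i)%:R *: (A i *m v) + (c i.+2)%:R *: (A i.+2 *m v).
Proof. by rewrite mulmxA (adjmx_distmx _ hdr hbip) mulmxDl -!scalemxAl. Qed.

Let E_mulAA l i : E l *m (A 1 *m (A i.+1 *m v)) =
  (b i)%:R *: (E l *m (A i *m v)) + (c i.+2)%:R *: (E l *m (A i.+2 *m v)).
Proof. by rewrite mulAA mulmxDr -!scalemxAr. Qed.

Lemma up_mid_down j : up j + mid j + down j = 0.
Proof. by apply: (sum_level hdr hbip Ev); apply: Wlow => //; apply: W_A. Qed.

(** A_j v does not reach level j + 4, nor A_(j-1) v level j + 3, so one term survives in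
    [raise_lower] and one in the recurrence. The latter starts at A_1; for j = 0 use A_0 = 1 and c_1
    = 1. *)
Lemma raise_up j : E j.+3 *m (A 1 *m up j) = (c j.+1)%:R *: up j.+1.
Proof.
have := raise_lower hdr hbip x j.+2 (A j *m v).
rewrite (level0 (l := j.+4)) ?mulmx0 ?addr0; [|by lia..].
move=> <-; case: j => [|j].
  by rewrite (distmx0 _ hdr) mul1mx (drg_c1 hdr D_gt0) scale1r.
by rewrite E_mulAA (level0 (l := j.+4)) ?scaler0 ?add0r //; lia.
Qed.

Lemma lower_up0 :
  E 2 *m (A 1 *m up 1) = (b 0)%:R *: up 0 + (c 2)%:R *: mid 0.
Proof.
rewrite -E_mulAA [RHS](raise_lower hdr hbip).
by rewrite [E 1 *m _]Wlow ?W_A // !mulmx0 add0r.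
Qed.

(** Both sides are the level j + 3 component of A A_(j+2) v. *)
Lemma lower_up j :
  E j.+3 *m (A 1 *m up j.+2) + E j.+3 *m (A 1 *m mid j) =
  (b j.+1)%:R *: up j.+1 + (c j.+3)%:R *: mid j.+1.
Proof. by rewrite -E_mulAA [RHS](raise_lower hdr hbip) addrC. Qed.

(** Both sides are the level j + 2 component of A A_(j+5) v, since A_(j+5) v vanishes on level j + 1
    and A_(j+6) v on level j + 2. *)
Lemma lower_down j :
  E j.+2 *m (A 1 *m down j.+1) = (b j.+4)%:R *: down j.
Proof.
have := raise_lower hdr hbip x j.+1 (A j.+4.+1 *m v).
rewrite (level0 (l := j.+1)) ?mulmx0 ?add0r; [|by lia..].
move=> <-; rewrite E_mulAA (level0 (i := j.+4.+2)) ?scaler0 ?addr0 //; lia.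
Qed.

Let E_proj l S w : E l *m (proj S *m w) = if S l then E l *m w else 0.
Proof.
apply/matrixP => r s; rewrite ord1 dual_idemE level_projE.
case: ifP => Sl; rewrite ?dual_idemE ?mxE; case: eqP => [->|_];
  by rewrite ?Sl ?mul0r ?mulr0 ?mul1r.
Qed.

(** If L killed w, by thinness it would kill level j + 3 of W, and the levels above j + 2 would span
    a submodule: not zero because of w, not W because of v. *)
Lemma lower_neq0 j w : w \in W -> E j.+3 *m w = w -> w != 0 ->
  E j.+2 *m (A 1 *m w) != 0.
Proof.
move=> Ww Ew w0; apply/negP => /eqP low0; pose S l := (j.+2 < l)%N.
have [u Wu||projW] := irr_cut hdr hbip hirr (S := S).
- apply: (@eq_levels C X e x) => l; rewrite E_proj /S; case: ltnP => // lj.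
  have Wp : A 1 *m (proj S *m u) \in W.
    by rewrite W_A // (module_level_proj hirr).
  case: l lj => [_|l lj]; first by rewrite Wlow.
  rewrite (raise_lower hdr hbip) !E_proj /S.
  rewrite ifF ?mulmx0 ?add0r; last by lia.
  case: ltnP => [jl|]; last by rewrite !mulmx0.
  have -> : l = j.+1 by lia.
  have [a ->] : exists a, E j.+3 *m u = a *: w.
    by apply: (thin_scalar hirr hthin (i := j.+3));
      rewrite ?dual_idemM ?eqxx ?W_E.
  by rewrite -!scalemxAr low0 scaler0.
- move=> /(_ w Ww)/(congr1 (mulmx (E j.+3))).
  by rewrite E_proj /S ltnSn Ew mulmx0; apply/eqP.
move/eqP: v_neq0; apply; rewrite -Ev -(projW v Wv) E_proj /S.
by case: ltnP => //; lia.
Qed.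

(** By [raise_up] and thinness R kills level j + 2 of W, so the levels up to j + 2 span a submodule;
    it contains v, hence is W. *)
Lemma level_above0 j w : up j != 0 -> up j.+1 = 0 -> w \in W ->
  E j.+3 *m w = 0.
Proof.
move=> upj upj1 Ww; pose S l := (l < j.+3)%N.
have [u Wu|projW|projW] := irr_cut hdr hbip hirr (S := S).
- apply: (@eq_levels C X e x) => -[|l]; rewrite E_proj /S // ltnS; case: ltnP => // lj.
  rewrite (raise_lower hdr hbip) !E_proj /S.
  rewrite [X in _ = _ + _ *m (_ *m X)]ifF ?mulmx0 ?addr0; last by lia.
  case: ltnP => [jl|]; last by rewrite !mulmx0.
  have -> : l = j.+2 by lia.
  have [a ->] : exists a, E j.+2 *m u = a *: up j.
    apply: (thin_scalar hirr hthin upj (up_mem j) (W_E _ Wu) (E_up j)).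
    by rewrite dual_idemM eqxx.
  by rewrite -!scalemxAr raise_up upj1 !scaler0.
- by case/eqP: v_neq0; rewrite -Ev -[E 2 *m v](E_proj 2 S v) projW ?mulmx0.
by rewrite -(projW w Ww) E_proj /S ltnn.
Qed.

(** Vanishing descends through [lower_down], because b_(j+4) is nonzero in this range. *)
Lemma down_eq0 j : (j.+4 <= D)%N -> down j = 0 -> down 0 = 0.
Proof.
elim: j => // j IH jD dn0; apply: IH; first exact: ltnW.
have /eqP := lower_down j; rewrite dn0 !mulmx0 eq_sym scaler_eq0 pnatr_eq0.
by rewrite -leqn0 leqNgt (drg_b_gt0 hdr) //= => /eqP.
Qed.

(** Vanishing ascends through [lower_down], because L is injective. *)
Lemma down0_eq0 j : down 0 = 0 -> down j = 0.
Proof.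
move=> dn0; elim: j => // j IH; apply/eqP/negPn/negP.
by move=> /(lower_neq0 (down_mem _) (E_down _)); rewrite lower_down IH scaler0
  eqxx.
Qed.

Lemma up_neq0 j : down 0 != 0 -> (j.+4 <= D)%N -> up j != 0.
Proof.
move=> dn0; elim: j => [_|j IH jD]; first by rewrite up0.
apply: contra dn0 => /eqP upj1; apply/eqP/(down_eq0 jD).
by rewrite -E_down (level_above0 (IH _) upj1) // ltnW.
Qed.

Let up1 : up 1 = A 1 *m v.
Proof.
apply: (@eq_levels C X e x) => l; rewrite dual_idemM; case: eqP => [->//|nl].
have [l2|l2] := ltnP l 2; first by rewrite Wlow ?W_A.
by rewrite level0 //; lia.
Qed.

Lemma polymx_ppoly j : (j.+2 <= D)%N ->
  polymx (ppoly C b c j.+2) (adjmx C e) *m v = up j.+2 - down j.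
Proof.
have lvl := @eq_levels C X e x.
have polyS i : (i.+2 <= D)%N -> polymx (ppoly C b c i.+2) (adjmx C e) *m v =
    polymx (ppoly C b c i) (adjmx C e) *m v + A i.+2 *m v.
  by move=> iD; rewrite ppolyS2 polymxD mulmxDl (fpoly_distmx _ hdr hbip iD).
have downE i : - down i = up i + mid i.
  by apply/eqP; rewrite eq_sym -subr_eq0 opprK up_mid_down.
(* For i < 2 the lowest component would lie on level 0 or 1, where W vanishes. *)
have splitA i : A i.+2 *m v =
    up i.+2 + mid i + (if i is i'.+2 then down i' else 0).
  apply: lvl => l; rewrite !mulmxDr !dual_idemM.
  have [l2|l2] := ltnP l 2.
    rewrite Wlow ?W_A // ifF ?ifF ?add0r; [|by lia..].
    case: i => [|[|i]]; rewrite ?mulmx0 // dual_idemM ifF //; lia.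
  case: eqP => [->|n1].
    rewrite ifF ?addr0; last by lia.
    by case: i => [|[|i]]; rewrite ?mulmx0 ?addr0 // dual_idemM ifF ?addr0 //;
      lia.
  rewrite add0r; case: eqP => [->|n2].
    by case: i n1 => [|[|i]]; rewrite ?mulmx0 ?addr0 // dual_idemM ifF ?addr0 //;
      lia.
  rewrite add0r; case: i n1 n2 => [|[|i]] n1 n2; rewrite ?mulmx0 ?dual_idemM;
    try (by rewrite level0 //; lia).
  by case: eqP => [->//|n3]; rewrite level0 //; lia.
elim/ltn_ind: j => -[_ jD|[_ jD|j IH jD]]; rewrite polyS // splitA downE.
- rewrite ppoly0 polymx1 mul1mx up0 addr0.
  by rewrite addrC -addrA; congr (_ + _); rewrite addrC.
- rewrite ppoly1 (fpoly_distmx _ hdr hbip D_gt0) addr0.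
  by rewrite -up1 addrCA.
rewrite IH //; last exact: ltnW (ltnW jD).
rewrite addrC -!addrA [X in _ + (_ + X)]addrC; congr (_ + _).
by rewrite subrK addrC.
Qed.

(** * The local eigenvalue and the ratios B_j *)

Variables (k : nat) (eta : C).
Hypotheses (regk : regular e k) (Eeta : E 2 *m (A 2 *m v) = eta *: v).

Lemma down0E : down 0 = - (1 + eta) *: v.
Proof.
have := up_mid_down 0; rewrite up0 /mid Eeta -[X in X + _ + _]scale1r -scalerDl.
by move/eqP; rewrite addrC addr_eq0 -scaleNr => /eqP.
Qed.

Lemma up_eta_m1 i : eta = -1 -> (i <= D)%N ->
  up i = polymx (ppoly C b c i) (adjmx C e) *m v.
Proof.
move=> etaE; have dn0 : down 0 = 0 by rewrite down0E etaE addrN oppr0 scale0r.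
case: i => [_|[_|i iD]]; last by rewrite polymx_ppoly // (down0_eq0 _ dn0) subr0.
  by rewrite ppoly0 polymx1 mul1mx up0.
by rewrite ppoly1 (fpoly_distmx _ hdr hbip D_gt0) up1.
Qed.

Hypothesis eta_neq : eta != -1.
Let psi : C := (b 2%N)%:R * (1 - (b 3%N)%:R / (1 + eta)).
Local Notation P i := ((Ppoly C b c i).[psi]).

Let eta1 : 1 + eta != 0.
Proof. by rewrite addrC -[1]opprK subr_eq0. Qed.

Let down0_neq0 : down 0 != 0.
Proof. by rewrite down0E scaler_eq0 oppr_eq0 (negPf eta1). Qed.

Let bC i : (i < D)%N -> (b i)%:R != 0 :> C.
Proof. by move/(drg_b_gt0 hdr); rewrite pnatr_eq0 lt0n. Qed.

Let cC i : (i < D)%N -> (c i.+1)%:R != 0 :> C.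
Proof. by move/(drg_c_gt0 hdr); rewrite pnatr_eq0 lt0n. Qed.

Let bE i : (i <= D)%N -> (b i)%:R = k%:R - (c i)%:R :> C.
Proof. by move=> iD; rewrite -(drg_bDc hdr hbip D_gt0 regk iD) natrD addrK. Qed.

Let P_rec i : (i.+2 <= D)%N ->
  (if odd i.+1 then psi else 1) * P i.+1 =
  (c i.+2)%:R * P i.+2 + (b i.+2)%:R * P i.
Proof.
apply: (Ppoly_rec (k := k) (drg_c0 hdr D_gt0) (drg_c_gt0 hdr)).
by move=> j jD; apply: (drg_bDc hdr hbip).
Qed.

Let P0 : P 0%N = 1. Proof. exact: Ppoly0E. Qed.
Let P1 : P 1%N = 1.
Proof.
have := @Ppoly1E C b c D (drg_c_gt0 hdr) psi D_gt0.
by rewrite (drg_c1 hdr D_gt0) mul1r.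
Qed.

(** The closed form of B_j, cross-multiplied so as to be usable before the denominator is known to
    be nonzero. *)
Let down_ratio (j : nat) (B : C) :=
  B * ((c j.+1)%:R * (c j.+2)%:R * P j.+2) =
  (b j.+2)%:R * (b j.+3)%:R * P j.

Lemma down_up j : (j.+4 <= D)%N ->
  [/\ P j != 0, P j.+1 != 0 & P j.+2 != 0] /\
  exists2 B, down j = B *: up j & down_ratio j B.
Proof.
elim/ltn_ind: j => -[_ _|j IH jD].
  (* This is psi - b_2; the value of psi is the one that makes B_0 = -(1 + eta) fit [down_ratio]. *)
  have c2P2 : (c 2)%:R * P 2 = - ((b 2)%:R * (b 3)%:R / (1 + eta)).
    have := @P_rec 0 (ltnW (ltnW D4)).
    rewrite /= P0 P1 !mulr1 => /eqP; rewrite -subr_eq => /eqP <-.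
    by rewrite /psi mulrBr mulr1 addrAC subrr add0r mulrA.
  split; last first.
    exists (- (1 + eta)); first by rewrite down0E up0.
    rewrite /down_ratio (drg_c1 hdr D_gt0) mul1r c2P2 P0 mulr1 mulrNN mulrC.
    by rewrite divfK.
  split; rewrite ?P0 ?P1 ?oner_eq0 //.
  have : (c 2)%:R * P 2 != 0.
    by rewrite c2P2 oppr_eq0 !mulf_neq0 ?invr_eq0 ?bC // ltnW.
  by apply: contraNneq => ->; rewrite mulr0.
have [[Pj0 Pj1 Pj2] [B dnj BE]] := IH j (ltnSn j) (ltnW jD).
have upj := up_neq0 down0_neq0 (ltnW jD).
have upj1 := up_neq0 down0_neq0 jD.
have [B' dnj1] : exists B', down j.+1 = B' *: up j.+1.
  by apply: (thin_scalar hirr hthin upj1 (up_mem _) (down_mem _)) (E_up _) _.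
(* [Y] is b_(j+2) + c_j B_(j-1), reducing to b_2 for j = 0. *)
have [Y lowE YE] : exists2 Y,
    E j.+2 *m (A 1 *m up j.+1) = (Y - (c j.+2)%:R * B) *: up j &
    Y * ((c j.+1)%:R * P j.+1) =
    (b j.+2)%:R * ((if odd j then psi else 1) * P j).
  have midE i Bi : down i = Bi *: up i -> mid i = - (1 + Bi) *: up i.
    move=> dni; have /eqP := up_mid_down i; rewrite dni addrAC -{1}[up i]scale1r.
    by rewrite -scalerDl addrC addr_eq0 scaleNr => /eqP.
  case: j => [|j] in IH jD BE dnj Pj0 Pj1 Pj2 upj upj1 B' dnj1 *.
    exists (b 2)%:R.
      rewrite lower_up0 (midE _ _ dnj) scalerA -scalerDl; congr (_ *: _).
      rewrite !bE ?(drg_c0 hdr) //; last exact: leq_trans D4.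
      by ring.
    by rewrite (drg_c1 hdr) // P0 P1 !mulr1.
  have [|_ [Z dnZ ZE]] := IH j (ltnW (ltnSn j.+1)); first exact: ltnW (ltnW jD).
  (* Here [Z] is the preceding ratio; b_(j+1) + c_(j+1) = k = b_(j+3) + c_(j+3) turns the
     coefficients of [lower_up] into this form. *)
  exists ((b j.+3)%:R + (c j.+1)%:R * Z).
    have := lower_up j; rewrite (midE _ _ dnZ) (midE _ _ dnj).
    rewrite -!scalemxAr raise_up !scalerA -scalerDl => /(canRL (addrK _)) ->.
    rewrite -scalerBl; congr (_ *: _).
    by rewrite !bE; [ring | clear -jD; lia..].
  rewrite P_rec; last by clear -jD; lia.
  apply: (etrans (y := (b j.+3)%:R * ((c j.+2)%:R * P j.+2) +
                       (b j.+2)%:R * (b j.+3)%:R * P j)); last by ring.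
  by rewrite -ZE; ring.
(* Injectivity of L at u_(j+1); this is the source of P_(j+3) being nonzero. *)
have lnz : Y - (c j.+2)%:R * B != 0.
  have := lower_neq0 (up_mem _) (E_up _) upj1.
  by rewrite lowE; apply: contraNneq => ->; rewrite scale0r.
have B'E : B' * (Y - (c j.+2)%:R * B) = (b j.+4)%:R * B.
  have := lower_down j; rewrite dnj1 dnj -!scalemxAr lowE !scalerA => /eqP.
  by rewrite -subr_eq0 -scalerBl scaler_eq0 (negPf upj) orbF subr_eq0 => /eqP.
have tE : (if odd j then psi else 1) * P j.+2 =
    (c j.+3)%:R * P j.+3 + (b j.+3)%:R * P j.+1.
  have := P_rec (ltnW (ltnW jD)).
  by rewrite -[odd j.+2]/(~~ ~~ odd j) negbK.
have [Pj3 B'P] : P j.+3 != 0 /\ down_ratio j.+1 B'.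
  have [Dj1 Dj2] : (j < D)%N /\ (j.+2 < D)%N by clear -jD; lia.
  exact: (ratio_step erefl YE BE tE B'E lnz (cC Dj1) (bC Dj2)).
by split=> //; exists B'.
Qed.

Let kparam_neq0 i : (i <= D)%N -> kparam C b c i != 0.
Proof.
elim: i => [_|i IH iD]; first by rewrite /kparam !big_ord0 divr1 oner_eq0.
rewrite kparamS mulf_neq0 //; first exact/IH/ltnW.
by rewrite mulf_neq0 ?invr_eq0; [|apply: bC|apply: cC].
Qed.

(** * Telescoping with weights *)

Let scaleP i := P i / (kparam C b c i * (b i)%:R * (b i.+1)%:R).

Lemma scaleP_down j : (j.+4 <= D)%N ->
  scaleP j.+2 *: down j = scaleP j *: up j.
Proof.
move=> jD; have [_ [B -> BE]] := down_up jD.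
rewrite scalerA; congr (_ *: _); rewrite /scaleP.
have [[bj0 bj1] [bj2 bj3]] : (((b j)%:R != 0 :> C) * ((b j.+1)%:R != 0 :> C)) *
  (((b j.+2)%:R != 0 :> C) * ((b j.+3)%:R != 0 :> C)) by rewrite !bC //; clear -jD; lia.
have [cj1 cj2] : ((c j.+1)%:R != 0 :> C) * ((c j.+2)%:R != 0 :> C).
  by rewrite !cC //; clear -jD; lia.
have kj : kparam C b c j != 0 by rewrite kparam_neq0 //; clear -jD; lia.
by rewrite !kparamS; apply: scale_step.
Qed.

(** By [polymx_ppoly] and [scaleP_down], the term of index i + 2 is the difference of the weighted
    [up] at i + 2 and at i. *)
Lemma scaleP_up i : (i.+2 <= D)%N ->
  scaleP i *: up i =
  \sum_(h < i.+1 | ~~ odd (i - h))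
    scaleP h *: (polymx (ppoly C b c h) (adjmx C e) *m v).
Proof.
elim/ltn_ind: i => -[_ _|[_ _|i IH iD]].
- by rewrite big_mkcond big_ord1 /= ppoly0 polymx1 mul1mx up0.
- rewrite big_mkcond 2!big_ord_recr big_ord0 /= !add0r ppoly1.
  by rewrite (fpoly_distmx _ hdr hbip D_gt0) up1.
rewrite (sum_same_parity _ (fun h => scaleP h *: (polymx (ppoly C b c h) _ *m v))).
rewrite -IH ?(ltnW (ltnW iD)) //.
by rewrite (polymx_ppoly (ltnW (ltnW iD))) scalerBr scaleP_down // addrC subrK.
Qed.

Lemma up_formula i : (i.+2 <= D)%N ->
  up i = \sum_(h < i.+1 | ~~ odd (i - h))
    (P h / P i *
     ((kparam C b c i * (b i)%:R * (b i.+1)%:R) /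
      (kparam C b c h * (b h)%:R * (b h.+1)%:R)))
    *: (polymx (ppoly C b c h) (adjmx C e) *m v).
Proof.
move=> iD; have Pi : P i != 0.
  (* From index 2 on, P_i is the third polynomial value in [down_up] at i - 2. *)
  case: i iD => [_|[_|i iD]]; rewrite ?P0 ?P1 ?oner_eq0 //.
  by have [[]] := down_up iD.
have scale0 : scaleP i != 0.
  have iD1 := ltnW iD; apply: mulf_neq0; rewrite // invr_eq0.
  by rewrite mulf_neq0 ?bC // mulf_neq0 ?bC // kparam_neq0 // ltnW.
rewrite -[up i](scalerK scale0) scaleP_up // scaler_sumr.
apply: eq_bigr => h _; rewrite scalerA; congr (_ *: _); rewrite /scaleP invf_div.
by rewrite mulrACA (mulrC _ (P h)) -mulrACA.
Qed.

End EndpointTwo.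

Theorem theorem16p3 (C : numClosedFieldType) (X : finType) (e : rel X)
  (b c : nat -> nat) (D k : nat) (theta : nat -> C)
  (x : X) (W : {vspace 'cV[C]_#|X|}) (eta : C) (v : 'cV[C]_#|X|)
  (hdr : distance_regular e b c) (hbip : bipartite e)
  (hD : diameter e = D) (hD4 : (4 <= D)%N)
  (hk : regular e k) (hk3 : (3 <= k)%N)
  (htheta : eigenvalue_enum (adjmx C e) D theta)
  (hirr : irreducible_Tmodule e x W) (hthin : thin e x W)
  (hend : has_endpoint e x W 2) (heta : local_eigenvalue e x W eta)
  (hlow : theta_tilde b (theta 1%N) < eta)
  (hupp : eta < theta_tilde b (theta (D %/ 2)%N))
  (hv : v \in subconst e x 2 W) (hv0 : v != 0) :
  (eta <> -1 ->
   let psi := (b 2%N)%:R * (1 - (b 3%N)%:R / (1 + eta)) in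
   forall i : nat, (i <= D - 2)%N ->
     dual_idem C e x (i + 2) *m distmx C e i *m v =
     \sum_(h < i.+1 | ~~ odd (i - h))
        ((Ppoly C b c h).[psi] / (Ppoly C b c i).[psi] *
         ((kparam C b c i * (b i)%:R * (b i.+1)%:R) /
          (kparam C b c h * (b h)%:R * (b h.+1)%:R)))
        *: (polymx (ppoly C b c h) (adjmx C e) *m v)) /\
  (eta = -1 ->
   forall i : nat, (i <= D - 2)%N ->
     dual_idem C e x (i + 2) *m distmx C e i *m v =
     polymx (ppoly C b c i) (adjmx C e) *m v).
Proof.
subst D; have [Wv Ev] := subconstP hirr _ _ hv.
have [W2 Wi0] := hend.
have Wlow i w : (i < 2)%N -> w \in W -> dual_idem C e x i *m w = 0.
  move=> i2 Ww; apply/eqP; rewrite -memv0 -(Wi0 i i2).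
  by apply/memv_imgP; exists w; rewrite ?lfunE.
(* By thinness v is a multiple of the eigenvector [u], so it has the same local eigenvalue. *)
have Eeta : dual_idem C e x 2 *m (distmx C e 2 *m v) = eta *: v.
  have [u [/(subconstP hirr)[Wu Eu] u0 uE]] := heta.
  have [a ->] := thin_scalar hirr hthin u0 Wu Wv Eu Ev.
  by move: uE; rewrite -!mulmxA Eu -!scalemxAr => ->; rewrite !scalerA mulrC.
have iD i : (i <= diameter e - 2)%N -> (i.+2 <= diameter e)%N.
  by move: hD4; clear; lia.
split=> [/eqP eta_neq psi i /iD iD2|eta_m1 i /iD iD2].
  rewrite addn2 -mulmxA.
  exact: (up_formula hdr hbip hirr hthin Wv Ev hv0 Wlow hD4 hk Eeta).
rewrite addn2 -mulmxA.
apply: (up_eta_m1 hdr hbip hirr hthin Wv Ev hv0 Wlow hD4 Eeta) => //.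
exact: ltnW (ltnW iD2).
Qed.
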